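(* Let $V\in\mathbb{R}^{m\times r}$, $W\in\mathbb{R}^{r\times n}$ with $V,W\ge\mathbf 0$, and let $M=P-N\in\mathbb{R}^{m\times n}$ with $P,N\ge\mathbf 0$. The cost function $\|M-VW\|_F$ is nonincreasing under the following update rules: $$V\leftarrow V\circ\frac{[PW^T]}{[VWW^T+NW^T]},\qquad W\leftarrow W\circ\frac{[V^TP]}{[V^TVW+V^TN]} .$$
   Context: $\circ$ is the Hadamard (component-wise) product and $\frac{[A]}{[B]}$ denotes component-wise division of matrices of the same size (defined where the entries of $B$ are nonzero). Inequalities are entrywise. ''Nonincreasing under the update rules'' means that replacing $V$ by the right-hand side of the first rule (with $W$ fixed), or replacing $W$ by the right-hand side of the second rule (with $V$ fixed), does not increase $\|M-VW\|_F$. *)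

(* Defs.v *)
From mathcomp Require Import all_boot all_order all_algebra.
From mathcomp Require Import reals.
Set Implicit Arguments.
Unset Strict Implicit.
Unset Printing Implicit Defensive.
Import Order.TTheory GRing.Theory Num.Theory.
Local Open Scope ring_scope.

Definition frobenius_norm (R : realType) (m n : nat) (A : 'M[R]_(m, n)) : R :=
  Num.sqrt (\sum_i \sum_j A i j ^+ 2).

Definition hadamard_mul (R : realType) (m n : nat) (A B : 'M[R]_(m, n)) :
    'M[R]_(m, n) :=
  map2_mx (fun a b => a * b) A B.

Definition hadamard_div (R : realType) (m n : nat) (A B : 'M[R]_(m, n)) :
    'M[R]_(m, n) :=
  map2_mx (fun a b => a / b) A B.

(* Division is total in MathComp, so the domain of [hadamard_div A B] has to
   be asserted separately, by [hadamard_div_defined B]. *)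
Definition hadamard_div_defined (R : realType) (m n : nat) (B : 'M[R]_(m, n)) :
    Prop :=
  forall i j, B i j != 0.

(* Main.v *)
(* For the second rule write the new matrix as W t entrywise, with
   t = [V^T P] / [V^T V W + V^T N]. The convexity bound
   (sum_k a_k t_k)^2 <= (sum_k a_k) (sum_k a_k t_k^2), for a_k >= 0, and
   2 (t - 1) <= t^2 - 1, applied to the part of the cost that is linear in N,
   majorize the change of the squared cost by a separable quadratic function
   of t, whose minimum is exactly the update rule. The first rule is the
   second one applied to the transposed matrices. *)
Require Import Defs.
From mathcomp Require Import all_boot all_order all_algebra.
From mathcomp Require Import reals.
From mathcomp Require Import ring lra.
Set Implicit Arguments.
Unset Strict Implicit.
Unset Printing Implicit Defensive.
Import Order.TTheory GRing.Theory Num.Theory.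
Local Open Scope ring_scope.

(** Cauchy-Schwarz in Lagrange form: twice the gap is the double sum of
    [a i * a j * (t i - t j) ^+ 2]. *)
Lemma sqr_sum_weighted_le (R : realDomainType) (I : finType) (a t : I -> R) :
  (forall i, 0 <= a i) ->
  (\sum_i a i * t i) ^+ 2 <= (\sum_i a i) * (\sum_i a i * t i ^+ 2).
Proof.
move=> a_ge0; set y := \sum_i a i * t i; set s := \sum_i a i.
set q := \sum_i a i * t i ^+ 2.
(* Doubling symmetrizes the double sum in [i] and [j], so that each term is a square with a
   nonnegative weight. *)
suff : y * y + y * y <= s * q + q * s by lra.
rewrite /y /s /q !big_distrlr -!big_split /=.
apply: ler_sum => i _; rewrite -!big_split /=; apply: ler_sum => j _.
rewrite -subr_ge0.
have -> : a i * (a j * t j ^+ 2) + a i * t i ^+ 2 * a j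
    - (a i * t i * (a j * t j) + a i * t i * (a j * t j))
  = a i * a j * (t i - t j) ^+ 2 by ring.
by apply: mulr_ge0; [exact: mulr_ge0|exact: sqr_ge0].
Qed.

(** With [y], [s], [q] as in the proof, the right side minus the left side is exactly
    [(s * q - y ^+ 2) + n * (q - 2 * y + s)], and both summands are nonnegative. *)
Lemma sqr_residual_diff_le (R : realDomainType) (I : finType) (a t : I -> R)
    (p n : R) :
  (forall i, 0 <= a i) -> 0 <= n ->
  (p - n - \sum_i a i * t i) ^+ 2 - (p - n - \sum_i a i) ^+ 2
  <= \sum_i a i * ((\sum_j a j + n) * (t i ^+ 2 - 1) - 2 * p * (t i - 1)).
Proof.
move=> a_ge0 n_ge0; have := sqr_sum_weighted_le t a_ge0.
set y := \sum_i a i * t i; set s := \sum_i a i.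
set q := \sum_i a i * t i ^+ 2 => y2_le.
have -> : \sum_i a i * ((s + n) * (t i ^+ 2 - 1) - 2 * p * (t i - 1))
    = (s + n) * (q - s) - 2 * p * (y - s).
  rewrite /q /y /s -!sumrB !mulr_sumr -sumrB.
  by apply: eq_bigr => i _; ring.
have : 0 <= n * (q - 2 * y + s).
  apply: mulr_ge0 => //.
  have -> : q - 2 * y + s = \sum_i a i * (t i - 1) ^+ 2.
    rewrite /q /y /s mulr_sumr -sumrB -big_split /=.
    by apply: eq_bigr => i _; ring.
  by apply: sumr_ge0 => i _; apply: mulr_ge0; [exact: a_ge0|exact: sqr_ge0].
by nra.
Qed.

Lemma frobenius_norm_tr (R : realType) (m n : nat) (A : 'M[R]_(m, n)) :
  frobenius_norm A^T = frobenius_norm A.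
Proof.
rewrite /frobenius_norm exchange_big /=.
by under eq_bigr do under eq_bigr do rewrite mxE.
Qed.

Lemma trmx_nneg (R : realType) (m n : nat) (A : 'M[R]_(m, n)) :
  A \is a mxOver Num.nneg -> A^T \is a mxOver Num.nneg.
Proof. by move=> /mxOverP A_ge0; apply/mxOverP => i j; rewrite mxE. Qed.

Lemma frobenius_norm_right_update_le (R : realType) (m n r : nat)
    (V : 'M[R]_(m, r)) (W : 'M[R]_(r, n)) (P N : 'M[R]_(m, n)) :
  V \is a mxOver Num.nneg -> W \is a mxOver Num.nneg ->
  N \is a mxOver Num.nneg ->
  hadamard_div_defined (V^T *m V *m W + V^T *m N) ->
  frobenius_norm
    (P - N - V *m hadamard_mul W
                    (hadamard_div (V^T *m P) (V^T *m V *m W + V^T *m N)))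
  <= frobenius_norm (P - N - V *m W).
Proof.
move=> /mxOverP V_ge0 /mxOverP W_ge0 /mxOverP N_ge0.
set D := _ + _ => D_neq0; set t := hadamard_div _ _.
have DE k j : D k j = \sum_i V i k * ((V *m W) i j + N i j).
  rewrite /D -mulmxA -mulmxDr mxE.
  by apply: eq_bigr => i _; rewrite !mxE.
have D_ge0 k j : 0 <= D k j.
  rewrite DE; apply: sumr_ge0 => i _; apply: mulr_ge0; first exact: V_ge0.
  apply: addr_ge0; last exact: N_ge0.
  by rewrite mxE; apply: sumr_ge0 => l _; apply: mulr_ge0;
    [exact: V_ge0|exact: W_ge0].
(* The nonvanishing of [D] enters here: it turns the entries of [V^T *m P] into [D k j * t k j]. *)
have DtE k j : \sum_i V i k * P i j = D k j * t k j.
  rewrite /t [X in _ * X]mxE mulrC divfK ?D_neq0// mxE.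
  by apply: eq_bigr => i _; rewrite mxE.
(* Summing over columns first reduces the claim to one column [j], since [W k j] affects column [j]
   only. *)
apply: ler_wsqrtr; rewrite -subr_le0 exchange_big /= [X in _ - X]exchange_big /=.
rewrite -sumrB; apply: sumr_le0 => j _; rewrite -sumrB.
apply: (@le_trans _ _ (\sum_i \sum_k V i k * W k j *
    (((V *m W) i j + N i j) * (t k j ^+ 2 - 1) - 2 * P i j * (t k j - 1)))).
  apply: ler_sum => i _.
  have a_ge0 k : 0 <= V i k * W k j.
    by apply: mulr_ge0; [exact: V_ge0|exact: W_ge0].
  have := sqr_residual_diff_le (t^~ j) (P i j) a_ge0 (N_ge0 i j).
  have -> : \sum_k V i k * W k j = (V *m W) i j by rewrite mxE.
  have -> : \sum_k V i k * W k j * t k j = (V *m hadamard_mul W t) i j.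
    by rewrite mxE; apply: eq_bigr => k _; rewrite [in RHS]mxE mulrA.
  (* Both products are generalized so that [mxE] expands only the outer subtractions. *)
  by move: (V *m W) (V *m hadamard_mul W t) => X Y; rewrite !mxE.
rewrite exchange_big /=; apply: sumr_le0 => k _.
have -> : \sum_i V i k * W k j *
    (((V *m W) i j + N i j) * (t k j ^+ 2 - 1) - 2 * P i j * (t k j - 1))
  = W k j * ((\sum_i V i k * ((V *m W) i j + N i j)) * (t k j ^+ 2 - 1)
             - 2 * (\sum_i V i k * P i j) * (t k j - 1)).
  rewrite mulr_suml mulr_sumr mulr_suml -sumrB mulr_sumr.
  by apply: eq_bigr => i _; ring.
rewrite -DE DtE.
(* The linear coefficient is [2 * D k j * t k j], so the quadratic evaluated at its own minimizer is
   minus a weighted square. *)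
have -> : D k j * (t k j ^+ 2 - 1) - 2 * (D k j * t k j) * (t k j - 1)
  = - (D k j * (t k j - 1) ^+ 2) by ring.
rewrite mulrN oppr_le0; apply: mulr_ge0; first exact: W_ge0.
by apply: mulr_ge0; [exact: D_ge0|exact: sqr_ge0].
Qed.

Theorem theorem8 (R : realType) (m n r : nat)
    (V : 'M[R]_(m, r)) (W : 'M[R]_(r, n)) (M P N : 'M[R]_(m, n))
    (hV : V \is a mxOver Num.nneg) (hW : W \is a mxOver Num.nneg)
    (hP : P \is a mxOver Num.nneg) (hN : N \is a mxOver Num.nneg)
    (hM : M = P - N) :
  (hadamard_div_defined (V *m W *m W^T + N *m W^T) ->
   frobenius_norm
     (M - hadamard_mul V
            (hadamard_div (P *m W^T) (V *m W *m W^T + N *m W^T)) *m W)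
   <= frobenius_norm (M - V *m W))
  /\
  (hadamard_div_defined (V^T *m V *m W + V^T *m N) ->
   frobenius_norm
     (M - V *m hadamard_mul W
                 (hadamard_div (V^T *m P) (V^T *m V *m W + V^T *m N)))
   <= frobenius_norm (M - V *m W)).
Proof.
split=> D_neq0; rewrite hM; last exact: frobenius_norm_right_update_le.
have DT : W^T^T *m W^T *m V^T + W^T^T *m N^T
    = (V *m W *m W^T + N *m W^T)^T.
  by rewrite [RHS]raddfD /= !trmx_mul !trmxK mulmxA.
have := @frobenius_norm_right_update_le _ _ _ _ W^T V^T P^T N^T
  (trmx_nneg hW) (trmx_nneg hV) (trmx_nneg hN).
rewrite DT trmxK.
have DT_neq0 : hadamard_div_defined (V *m W *m W^T + N *m W^T)^T.
  by move=> i j; rewrite mxE; exact: D_neq0.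
move=> /(_ DT_neq0).
have -> : W *m P^T = (P *m W^T)^T by rewrite trmx_mul trmxK.
(* All transposes are gathered into one around each residual, where the norm does not see it. *)
rewrite /hadamard_mul /hadamard_div -!map2_trmx -!trmx_mul -!raddfB /=.
by rewrite !frobenius_norm_tr.
Qed.
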